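(* For all integers $n \geq 0$, $$\mathrm{RD}^{(4,9)}(24n+23) \equiv 0 \pmod{24},\quad \mathrm{RD}^{(4,9)}(48n+29) \equiv 0 \pmod{24},\quad \mathrm{RD}^{(4,9)}(96n+89) \equiv 0 \pmod{24}.$$
   Context: For a nonnegative integer $n$, $\mathrm{RD}^{(4,9)}(n)$ denotes the number of partitions of $n$ into parts that are simultaneously 4-regular and 9-distinct, i.e., partitions of $n$ in which no part is divisible by $4$ and each distinct part appears at least once and at most $8$ times. Equivalently, writing $f_k = \prod_{m\ge1}(1-q^{km})$, $\sum_{n\ge0}\mathrm{RD}^{(4,9)}(n)q^n = \frac{f_9 f_4}{f_1 f_{36}}$. *)

(* Defs.v *)
From mathcomp Require Import all_boot.

Set Implicit Arguments.
Unset Strict Implicit.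
Unset Printing Implicit Defensive.

Definition is_partition (n : nat) (s : seq nat) : bool :=
  [&& sorted geq s, 0 \notin s & sumn s == n].

Definition regular (l : nat) (s : seq nat) : bool :=
  all (fun k => ~~ (l %| k)) s.

(* "t-distinct": every part is repeated at most t - 1 times. *)
Definition distinct (t : nat) (s : seq nat) : bool :=
  all (fun k => count_mem k s < t) s.

(* A partition of n has at most n parts, each of them at most n, so it is a
   sequence of length <= n over 'I_n.+1; this bound is there only to have a
   finite type to count in. *)
Definition RD (l t n : nat) : nat :=
  #|[set s : n.-bseq 'I_n.+1 |
      let p := [seq val i | i <- s] in
      [&& is_partition n p, regular l p & distinct t p]]|.

(* Main.v *)
Require Import Defs.
From HB Require Import structures.
From mathcomp Require Import all_boot.
From mathcomp Require Import all_order all_algebra.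
From mathcomp Require Import zify ring.
From mathcomp Require Import boolp.

Set Implicit Arguments.
Unset Strict Implicit.
Unset Printing Implicit Defensive.

Import Order.TTheory GRing.Theory Num.Theory.

(** Replacing q by -q turns f_9 f_4 / (f_1 f_36) into
    psi(q) phi(q^9) / (phi(q) psi(q^9)), where phi = sum q^(n^2) and
    psi = sum q^(2 n^2 + n) over the integers; this only needs
    psi / phi = prod 1 / ((1 + q^k) (1 - q^2k)), k odd, an instance of Jacobi's
    triple product.  With phi(q) = phi(q^9) + 2 q Omega(q^3) and
    psi(q) = alpha(q^3) + q psi(q^9), the coefficients of q^(3k+2) form the
    series
      2 phi3 Omega (4 psi psi2 - 3 psi3 phi3) / (psi3 (phi3^3 + 8 q Omega^3)),
    phi3 = phi(q^3) etc., thanks to the identity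
    alpha Omega + psi3 phi3 = 2 psi psi2, which is a splitting of the lattice
    Z^2 into three cosets.  Modulo 8 this is 2 Omega phi3, whose k-th
    coefficient counts the (x, y) with (3x+1)^2 + (3y)^2 = 3k+1: for the
    k of interest there are none, as 3k+1 is a power of 2 times a number that is
    3 modulo 4.  Modulo 3 it is
    - phi Omega (by Frobenius and psi^2 = phi psi2), whose k-th coefficient
    counts representations of 3k+1 by x^2 + 3y^2; for odd k these come in
    triples, by multiplication with cube roots of unity. *)

(** * Counting partitions by multiplicities *)

Lemma sumn_count M (p : seq nat) : all (fun k => k < M) p ->
  sumn p = \sum_(i < M) i * count_mem (i : nat) p.
Proof.
elim: p => [|x p IH] /=; first by rewrite big1 // => i _; rewrite muln0.
case/andP=> xM /IH ->.
transitivity (\sum_(i < M) (i * (x == i) + i * count_mem (i : nat) p)).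
  rewrite big_split /=; congr (_ + _).
  rewrite (bigD1 (Ordinal xM)) //= eqxx muln1 big1 ?addn0 // => i ix.
  by rewrite (_ : (x == i) = false) ?muln0 //; apply: contraNF ix => /eqP xi;
    apply/eqP/val_inj; rewrite /= xi.
by apply: eq_bigr => i _; rewrite -mulnDr.
Qed.

Lemma mem_leq_sumn (p : seq nat) k : k \in p -> k <= sumn p.
Proof.
elim: p => //= x p IH; rewrite in_cons => /orP[/eqP ->|/IH]; first exact: leq_addr.
by move=> h; apply: leq_trans h _; rewrite leq_addl.
Qed.

Lemma size_leq_sumn (p : seq nat) : 0 \notin p -> size p <= sumn p.
Proof.
by elim: p => //= x p IH; rewrite in_cons negb_or => /andP[x0 /IH]; lia.
Qed.

(** The inverse of [mults]: rebuilds the partition from its multiplicities. Sorting puts it in the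
    decreasing order that [is_partition] asks for. *)
Definition expand M t (f : {ffun 'I_M -> 'I_t.+1}) : seq nat :=
  sort geq (flatten [seq nseq (f i) (i : nat) | i <- enum 'I_M]).

Lemma count_expand M t (f : {ffun 'I_M -> 'I_t.+1}) (i : 'I_M) :
  count_mem (i : nat) (expand f) = f i.
Proof.
have /permP -> : perm_eq (expand f) (flatten [seq nseq (f i) (i : nat) | i <- enum
  'I_M]).
  by rewrite perm_sort.
rewrite count_flatten -map_comp sumnE big_map big_enum /=.
rewrite (bigD1 i) //= count_nseq /= eqxx mul1n big1 ?addn0 // => j ji.
by rewrite count_nseq /= (_ : (_ == _) = false) //; apply: contraNF ji => /eqP e;
  apply/eqP/val_inj; rewrite /= e.
Qed.

Lemma mem_expand M t (f : {ffun 'I_M -> 'I_t.+1}) k :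
  k \in expand f -> exists i : 'I_M, k = i /\ 0 < f i.
Proof.
rewrite mem_sort => /flattenP[l /mapP[i _ ->]]; rewrite mem_nseq => /andP[h /eqP ->].
by exists i.
Qed.

(** [inord] would turn a count above [t] into 0; t.+1-distinctness excludes that case. *)
Definition mults M t n (s : n.-bseq 'I_n.+1) : {ffun 'I_M -> 'I_t.+1} :=
  [ffun i : 'I_M => inord (count_mem (i : nat) [seq val j | j <- s])].

(** [mults] and [expand] are inverse bijections. The part 0 is excluded because [l %| 0] forces its
    multiplicity to vanish. The bound [M] is left free so that the number of factors of the
    generating product can be chosen later. *)
Lemma card_RD l t n M : n < M ->
  RD l t.+1 n = #|[set f : {ffun 'I_M -> 'I_t.+1} |
     [forall i : 'I_M, (l %| i) ==> (f i == ord0)] && (\sum_(i < M) i * f i == n)]|.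
Proof.
move=> nM; rewrite /RD; set S := [set s | _]; set F := [set f | _].
have multsE s (i : 'I_M) : s \in S -> mults M t s i =
  count_mem (i : nat) [seq val j | j <- s] :> nat.
  rewrite inE => /and3P[_ _ /allP d]; rewrite ffunE inordK //.
  have [h|/count_memPn -> //] := boolP ((i : nat) \in [seq val j | j <- s]).
  by have := d _ h.
have ltM s : all (fun k => k < M) [seq val j | j <- (s : n.-bseq 'I_n.+1)].
  by apply/allP => k /mapP[j _ ->]; apply: leq_trans (ltn_ord j) _.
have inj : {in S &, injective (@mults M t n)}.
  move=> s s' hs hs' e; apply: val_inj; apply: (inj_map val_inj).
  move: (hs) (hs'); rewrite !inE =>
    /and3P[/and3P[so _ _] _ _] /and3P[/and3P[so' _ _] _ _].
  apply: (sorted_eq _ _ so so').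
  - by move=> a b c /= ba cb; apply: leq_trans cb ba.
  - by move=> a b /=; rewrite andbC => /anti_leq.
  apply/allP => k _; apply/eqP.
  case: (ltnP k M) => kM.
    by have := congr1 (fun f : {ffun 'I_M -> 'I_t.+1} => f (Ordinal kM) : nat) e;
      rewrite !multsE.
  have h r : k \notin [seq val j | j <- (r : n.-bseq 'I_n.+1)].
    by apply/negP => /(allP (ltM r)); rewrite ltnNge kM.
  by rewrite !(count_memPn (h _)).
rewrite -(card_in_imset inj); apply: eq_card => f.
apply/imsetP/idP => [[s hs ->]|].
  have := hs; rewrite !inE => /and3P[/and3P[_ _ /eqP sn] /allP r _].
  apply/andP; split.
    apply/forallP => i; apply/implyP => li; apply/eqP/val_inj; rewrite /= multsE //.
    by apply/count_memPn/negP => /r; rewrite li.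
  by rewrite -[X in _ == X]sn (sumn_count (ltM s)); apply/eqP/eq_bigr => i _;
    rewrite multsE.
rewrite inE => /andP[/forallP fl /eqP fs].
have nz : 0 \notin expand f.
  apply/negP => /mem_expand[i [i0 fi]]; have := fl i.
  by rewrite -i0 dvdn0 => /eqP h; rewrite h in fi.
have sn : sumn (expand f) = n.
  rewrite (@sumn_count M); last by apply/allP => k /mem_expand[i [-> _]].
  by rewrite -[RHS]fs; apply: eq_bigr => i _; rewrite count_expand.
have sz : size [seq (inord k : 'I_n.+1) | k <- expand f] <= n.
  by rewrite size_map -[X in _ <= X]sn size_leq_sumn.
have ve : [seq val j | j <- Bseq sz] = expand f.
  rewrite /= -map_comp -[RHS]map_id; apply/eq_in_map => k hk /=.
  by rewrite inordK // ltnS -sn mem_leq_sumn.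
exists (Bseq sz).
  rewrite inE ve; apply/and3P; split.
  - rewrite /is_partition nz sn eqxx !andbT; apply: sort_sorted => a b.
    by case/orP: (leq_total a b) => h; apply/orP; [right|left].
  - apply/allP => k /mem_expand[i [-> fi]]; apply/negP => li.
    by have := fl i; rewrite li => /eqP h; rewrite h in fi.
  - by apply/allP => k /mem_expand[i [-> fi]]; rewrite count_expand.
by apply/ffunP => i; rewrite ffunE ve count_expand inord_val.
Qed.

Local Open Scope ring_scope.

(** * Formal power series *)

(** A wrapper around functions, so that the ring structure put on it is the Cauchy product and not a
    pointwise one. *)
Record series (R : Type) := Series { coefs :> nat -> R }.

Lemma seriesP (R : Type) (p r : series R) : (forall k, p k = r k) -> p = r.
Proof. by case: p r => [p] [r] /= h; congr Series; apply: funext. Qed.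

HB.instance Definition _ (R : Type) := gen_eqMixin (series R).
HB.instance Definition _ (R : Type) := gen_choiceMixin (series R).

Definition trunc (R : comNzRingType) (n : nat) (p : series R) : {poly R} :=
  \poly_(i < n) p i.
Definition of_poly (R : comNzRingType) (P : {poly R}) : series R :=
  Series (fun k => P`_k).
Definition sadd (R : comNzRingType) (p r : series R) :=
  Series (fun k => p k + r k).
Definition sopp (R : comNzRingType) (p : series R) := Series (fun k => - p k).
Definition smul (R : comNzRingType) (p r : series R) :=
  Series (fun k => \sum_(i < k.+1) p i * r (k - i)%N).

Lemma coef_mul_eq (R : comNzRingType) (n : nat) (P P' Q Q' : {poly R}) :
  (forall k, (k < n)%N -> P`_k = P'`_k) -> (forall k, (k < n)%N -> Q`_k = Q'`_k) ->
  forall k, (k < n)%N -> (P * Q)`_k = (P' * Q')`_k.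
Proof.
move=> hP hQ k kn; rewrite !coefM; apply: eq_bigr => i _.
by rewrite hP ?hQ //; case: i => i /= hi; lia.
Qed.

Lemma coef_trunc (R : comNzRingType) (n : nat) (p : series R) k :
  (k < n)%N -> (trunc n p)`_k = p k.
Proof. by move=> kn; rewrite coef_poly kn. Qed.

Lemma smul_trunc (R : comNzRingType) (n : nat) (p r : series R) k :
  (k < n)%N -> smul p r k = (trunc n p * trunc n r)`_k.
Proof.
move=> kn; rewrite coefM; apply: eq_bigr => -[i hi] _ /=.
by rewrite !coef_trunc //; lia.
Qed.

Lemma saddA R : associative (@sadd R).
Proof. by move=> p r s; apply: seriesP => k /=; rewrite addrA. Qed.
Lemma saddC R : commutative (@sadd R).
Proof. by move=> p r; apply: seriesP => k /=; rewrite addrC. Qed.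
Lemma sadd0 R : left_id (Series (fun=> 0)) (@sadd R).
Proof. by move=> p; apply: seriesP => k /=; rewrite add0r. Qed.
Lemma saddN R : left_inverse (Series (fun=> 0)) (@sopp R) (@sadd R).
Proof. by move=> p; apply: seriesP => k /=; rewrite addNr. Qed.

HB.instance Definition _ (R : comNzRingType) :=
  GRing.isZmodule.Build (series R) (@saddA R) (@saddC R) (@sadd0 R) (@saddN R).

(** Inherited from polynomials: coefficient [k] does not change when each factor is truncated beyond
    degree [k]. *)
Lemma smulA R : associative (@smul R).
Proof.
move=> p r s; apply: seriesP => k.
rewrite !(@smul_trunc _ k.+1) //.
transitivity ((trunc k.+1 p * (trunc k.+1 r * trunc k.+1 s))`_k).
  apply: (@coef_mul_eq _ k.+1) => // i ik.
  by rewrite coef_trunc // (@smul_trunc _ k.+1).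
rewrite mulrA; apply: (@coef_mul_eq _ k.+1) => // i ik.
by rewrite coef_trunc // (@smul_trunc _ k.+1).
Qed.
Lemma smulC R : commutative (@smul R).
Proof.
by move=> p r; apply: seriesP => k; rewrite !(@smul_trunc _ k.+1) // mulrC.
Qed.
Lemma smul1 R : left_id (of_poly 1) (@smul R).
Proof.
move=> p; apply: seriesP => k /=; rewrite big_ord_recl big1 => [|i _] /=.
  by rewrite coef1 mul1r addr0 subn0.
by rewrite coef1 mul0r.
Qed.
Lemma smulDl R : left_distributive (@smul R) +%R.
Proof.
move=> p r s; apply: seriesP => k /=.
by rewrite -big_split; apply: eq_bigr => i _ /=; rewrite mulrDl.
Qed.
Lemma sone_neq0 (R : comNzRingType) : of_poly 1 != 0 :> series R.
Proof.
apply/eqP => /(congr1 (fun p : series R => p 0%N)) /eqP /=.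
by rewrite coef1 oner_eq0.
Qed.

HB.instance Definition _ (R : comNzRingType) :=
  GRing.Zmodule_isComNzRing.Build (series R)
    (@smulA R) (@smulC R) (@smul1 R) (@smulDl R) (@sone_neq0 R).

Lemma coefs_add (R : comNzRingType) (p r : series R) k : (p + r) k = p k + r k.
Proof. by []. Qed.
Lemma coefs_opp (R : comNzRingType) (p : series R) k : (- p) k = - p k.
Proof. by []. Qed.
Lemma coefs_mul (R : comNzRingType) (p r : series R) k :
  (p * r) k = \sum_(i < k.+1) p i * r (k - i)%N.
Proof. by []. Qed.
Lemma coefs0 (R : comNzRingType) k : (0 : series R) k = 0.
Proof. by []. Qed.
Lemma coefs1 (R : comNzRingType) k : (1 : series R) k = (k == 0)%:R.
Proof. by rewrite -coef1. Qed.
Lemma coefs_muln (R : comNzRingType) (p : series R) m k : (p *+ m) k = p k *+ m.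
Proof. by elim: m => [|m IH]; rewrite ?mulr0n // !mulrS coefs_add IH. Qed.
Lemma coefs_sum (R : comNzRingType) (I : Type) (s : seq I) (P : pred I)
    (F : I -> series R) k :
  (\sum_(i <- s | P i) F i) k = \sum_(i <- s | P i) F i k.
Proof.
by elim/big_rec2: _ => // i x y _ <-; rewrite coefs_add.
Qed.

Lemma of_polyB (R : comNzRingType) (P Q : {poly R}) : of_poly (P - Q) = of_poly P
  - of_poly Q.
Proof. by apply: seriesP => k /=; rewrite coefB. Qed.
Lemma of_polyM (R : comNzRingType) (P Q : {poly R}) : of_poly (P * Q) =
  of_poly P * of_poly Q.
Proof. by apply: seriesP => k /=; rewrite coefM. Qed.
HB.instance Definition _ (R : comNzRingType) :=
  GRing.isZmodMorphism.Build {poly R} (series R) (@of_poly R) (@of_polyB R).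
HB.instance Definition _ (R : comNzRingType) :=
  GRing.isMonoidMorphism.Build {poly R} (series R) (@of_poly R)
   (erefl, @of_polyM R).

Definition q {R : comNzRingType} : series R := of_poly 'X.

Lemma coefs_qn (R : comNzRingType) n k : (q ^+ n : series R) k = (k == n)%:R.
Proof. by rewrite /q -rmorphXn /= coefXn. Qed.

Lemma coefs_qnM (R : comNzRingType) n (p : series R) k :
  (q ^+ n * p) k = if (k < n)%N then 0 else p (k - n)%N.
Proof.
rewrite (smul_trunc _ _ (leqnn k.+1)).
rewrite (@coef_mul_eq _ k.+1 _ 'X^n _ (trunc k.+1 p)) // => [|i ik].
  by rewrite coefXnM; case: ifP => // h; rewrite coef_trunc //; lia.
by rewrite coef_trunc // coefs_qn coefXn.
Qed.


(** * The substitution of q^d for q, and dissection modulo 3 *)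

Definition subs (R : comNzRingType) (d : nat) (p : series R) : series R :=
  Series (fun k => if (d %| k)%N then p (k %/ d)%N else 0).

Lemma subs_trunc (R : comNzRingType) d n (p : series R) k :
  (0 < d)%N -> (k < n)%N -> subs d p k = (trunc n p \Po 'X^d)`_k.
Proof.
move=> d0 kn; rewrite coef_comp_poly_Xn //=; case: ifP => // dk.
by rewrite coef_trunc //; apply: leq_ltn_trans kn; rewrite leq_div.
Qed.

Lemma coef_comp_Xn_eq (R : comNzRingType) d n (P Q : {poly R}) : (0 < d)%N ->
  (forall k, (k < n)%N -> P`_k = Q`_k) ->
  forall k, (k < n)%N -> (P \Po 'X^d)`_k = (Q \Po 'X^d)`_k.
Proof.
move=> d0 h k kn; rewrite !coef_comp_poly_Xn //; case: ifP => // dk.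
by apply: h; apply: leq_ltn_trans kn; rewrite leq_div.
Qed.

(** On truncations [subs d] is composition with ['X^d], which is multiplicative. *)
Lemma subsM (R : comNzRingType) d (p r : series R) :
  (0 < d)%N -> subs d (p * r) = subs d p * subs d r.
Proof.
move=> d0; apply: seriesP => k; rewrite (smul_trunc _ _ (leqnn k.+1)).
rewrite (subs_trunc _ d0 (leqnn _)).
rewrite (@coef_mul_eq _ k.+1 _ (trunc k.+1 p \Po 'X^d) _ (trunc k.+1 r \Po 'X^d)) //.
- rewrite -comp_polyM; apply: (coef_comp_Xn_eq d0 _ (leqnn _)) => i ik.
  by rewrite coef_trunc // -smul_trunc.
- by move=> i ik; rewrite coef_trunc // (subs_trunc _ d0 ik).
- by move=> i ik; rewrite coef_trunc // (subs_trunc _ d0 ik).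
Qed.

Lemma subsD (R : comNzRingType) d (p r : series R) :
  subs d (p + r) = subs d p + subs d r.
Proof.
by apply: seriesP => k; rewrite coefs_add /= ; case: ifP; rewrite ?addr0.
Qed.
Lemma subsN (R : comNzRingType) d (p : series R) : subs d (- p) = - subs d p.
Proof.
by apply: seriesP => k; rewrite coefs_opp /= ; case: ifP; rewrite ?oppr0.
Qed.
Lemma subs_q (R : comNzRingType) d n : (0 < d)%N -> subs d (q ^+ n : series R) =
  q ^+ (d * n).
Proof.
move=> d0; apply: seriesP => k; rewrite /= !coefs_qn.
case: ifP => [/dvdnP[m ->]|h].
  by rewrite mulnK // [(m * d)%N]mulnC eqn_pmul2l.
by case: eqP => // e; rewrite e dvdn_mulr in h.
Qed.
Lemma subs1 (R : comNzRingType) d : (0 < d)%N -> subs d (1 : series R) = 1.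
Proof. by move=> d0; rewrite -[LHS]/(subs d (q ^+ 0)) subs_q // muln0. Qed.
Lemma subsX (R : comNzRingType) d (p : series R) n : (0 < d)%N -> subs d (p ^+ n) =
  subs d p ^+ n.
Proof. by move=> d0; elim: n => [|n IH];
  rewrite ?expr0 ?subs1 // !exprS subsM // IH. Qed.
Lemma subs_muln (R : comNzRingType) d (p : series R) n : (0 < d)%N -> subs d (p
  *+ n) = subs d p *+ n.
Proof.
by move=> d0; apply: seriesP => k; rewrite coefs_muln /= coefs_muln; case: ifP;
  rewrite ?mul0rn.
Qed.

Definition dis (R : comNzRingType) (d r : nat) (p : series R) : series R :=
  Series (fun k => p (d * k + r)%N).

Lemma subs_mul (R : comNzRingType) d (p : series R) k :
  (0 < d)%N -> subs d p (d * k)%N = p k.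
Proof. by move=> d0 /=; rewrite dvdn_mulr ?mulKn. Qed.

Lemma subs_ndvd (R : comNzRingType) d (p : series R) k :
  ~~ (d %| k)%N -> subs d p k = 0.
Proof. by move=> /negPf /= ->. Qed.

Lemma coefs_dissection (R : comNzRingType) (u0 u1 u2 : series R) k :
  let u := subs 3 u0 + q * subs 3 u1 + q ^+ 2 * subs 3 u2 in
  [/\ u (3 * k)%N = u0 k, u (3 * k + 1)%N = u1 k & u (3 * k + 2)%N = u2 k].
Proof.
move=> u; rewrite /u -[q in q * _]expr1; split; rewrite !coefs_add !coefs_qnM.
- rewrite subs_mul //; case: ifP => ?; case: ifP => ?;
    rewrite ?subs_ndvd ?addr0 //; lia.
- rewrite subs_ndvd ?add0r; last lia.
  rewrite ifN; last lia.
  rewrite addnK subs_mul //; case: ifP => ?; rewrite ?subs_ndvd ?addr0 //; lia.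
- rewrite subs_ndvd ?add0r; last lia.
  rewrite !ifN; [|lia|lia].
  by rewrite subs_ndvd ?add0r ?addnK ?subs_mul //; lia.
Qed.

Lemma disE (R : comNzRingType) (p : series R) :
  p = subs 3 (dis 3 0 p) + q * subs 3 (dis 3 1 p) + q ^+ 2 * subs 3 (dis 3 2 p).
Proof.
apply: seriesP => k.
have: (k %% 3 < 3)%N by rewrite ltn_mod.
move: (divn_eq k 3); move: (k %/ 3)%N (k %% 3)%N => a r -> _r.
have [h0 h1 h2] := coefs_dissection (dis 3 0 p) (dis 3 1 p) (dis 3 2 p) a.
rewrite [(a * 3)%N]mulnC; case: r _r => [|[|[|//]]] _.
- by rewrite addn0 h0 /= addn0.
- by rewrite h1.
- by rewrite h2.
Qed.

Lemma dis_subs (R : comNzRingType) (u0 u1 u2 : series R) :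
  dis 3 2 (subs 3 u0 + q * subs 3 u1 + q ^+ 2 * subs 3 u2) = u2.
Proof. by apply: seriesP => k; case: (coefs_dissection u0 u1 u2 k). Qed.

(** A series in q^3 multiplies each of the three components of [p] separately. *)
Lemma disM (R : comNzRingType) (p c : series R) :
  dis 3 2 (p * subs 3 c) = dis 3 2 p * c.
Proof.
rewrite -[RHS](dis_subs (dis 3 0 p * c) (dis 3 1 p * c)) !subsM //.
by rewrite {1}(disE p); congr dis; ring.
Qed.

(** * Theta series *)

Lemma uniq_flatten_map (I T : eqType) (s : seq I) (F : I -> seq T) :
  uniq s -> (forall i, uniq (F i)) ->
  (forall i j x, x \in F i -> x \in F j -> i = j) ->
  uniq (flatten (map F s)).
Proof.
move=> us uF dF; elim: s us => //= i s IH /andP[is_ us].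
rewrite cat_uniq uF IH // andbT; apply/hasPn => x /flattenP[l /mapP[j js ->] xj].
by apply: contra is_ => xi; rewrite (dF _ _ _ xi xj).
Qed.

(* [gens e p] says that p is the sum of q ^ (e x) over all x : T. *)
Definition gens (T : eqType) (e : T -> int) (p : series int) :=
  (forall x, 0 <= e x) /\
  forall k : nat, exists L : seq T,
    [/\ uniq L, forall x, (x \in L) = (e x == k%:Z) & p k = (size L)%:R].

(** Theta identities are proved through this: it suffices that both sides enumerate the same
    exponents. *)
Lemma gens_uniq (T : eqType) (e : T -> int) (p r : series int) :
  gens e p -> gens e r -> p = r.
Proof.
move=> [_ hp] [_ hr]; apply: seriesP => k.
have [L [uL mL ->]] := hp k; have [L' [uL' mL' ->]] := hr k.
by congr (_%:R); apply/eqP; rewrite -uniq_size_uniq // => x; rewrite mL mL'.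
Qed.

Lemma gens_ext (T : eqType) (e e' : T -> int) (p : series int) :
  gens e p -> e =1 e' -> gens e' p.
Proof.
move=> [e0 hp] ee; split=> [x|k]; first by rewrite -ee.
by have [L [uL mL ->]] := hp k; exists L; split=> // x; rewrite mL ee.
Qed.

Lemma gens_mul (T T' : eqType) (e : T -> int) (e' : T' -> int) p p' :
  gens e p -> gens e' p' -> gens (fun z : T * T' => e z.1 + e' z.2) (p * p').
Proof.
move=> [e0 hp] [e0' hp']; split=> [x|k]; first exact: addr_ge0.
have [L hL] := choice hp; have [L' hL'] := choice hp'.
exists (flatten [seq [seq (x, y) | x <- L i, y <- L' (k - i)%N] | i <- iota 0 k.+1]).
split.
- apply: uniq_flatten_map; first exact: iota_uniq.
    move=> i; apply: allpairs_uniq; try by case: (hL i); case: (hL' (k - i)%N).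
    by case=> a b [c d].
  move=> i j [x y] /allpairsP[[a b] /= [ha _ [? ?]]] /allpairsP[[c d] /= [hc _ [? ?]]].
  subst; move: ha hc; have [_ -> _] := hL i; have [_ -> _] := hL j.
  by move=> /eqP-> /eqP[].
- move=> [x y]; apply/flattenP/eqP => [[l /mapP[i]]|h].
    rewrite mem_iota => hi -> /allpairsP[[a b] /= [ha hb [? ?]]]; subst.
    move: ha hb; have [_ -> _] := hL i; have [_ -> _] := hL' (k - i)%N.
    by move=> /eqP /= -> /eqP ->; lia.
  rewrite /= in h; have [i hi] : exists i : nat, e x = i by exists `|e x|%N;
    rewrite gez0_abs.
  have hj : e' y = (k - i)%N by have := e0' y; lia.
  exists [seq (x, y) | x <- L i, y <- L' (k - i)%N].
    apply: (map_f (fun i => [seq (x, y) | x <- L i, y <- L' (k - i)%N])).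
    by rewrite mem_iota; have := e0' y; lia.
  apply: allpairs_f; first by have [_ -> _] := hL i; rewrite hi.
  by have [_ -> _] := hL' (k - i)%N; rewrite hj.
- rewrite coefs_mul size_flatten /shape -map_comp sumnE big_map natr_sum.
  rewrite -[iota 0 k.+1]/(index_iota 0 k.+1) big_mkord; apply: eq_bigr => i _ /=.
  rewrite size_allpairs natrM.
  by have [_ _ ->] := hL i; have [_ _ ->] := hL' (k - i)%N.
Qed.

(** The images of the [f i] partition [T], so the sum splits accordingly. The dissections and
    product identities below are instances, each with an explicit splitting of Z or Z^2. *)
Lemma gens_cover (I : finType) (T T' : eqType) (f : I -> T' -> T) (e : T -> int)
    (p : I -> series int) :
  (forall x, exists i y, f i y = x) ->
  (forall i j y z, f i y = f j z -> i = j /\ y = z) ->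
  (forall i, gens (fun y => e (f i y)) (p i)) -> gens e (\sum_i p i).
Proof.
move=> fsurj finj hp; split=> [x|k].
  by have [i [y <-]] := fsurj x; case: (hp i).
have [L hL] := choice (fun i => (hp i).2 k).
exists (flatten [seq [seq f i y | y <- L i] | i <- enum I]); split.
- apply: uniq_flatten_map; first exact: enum_uniq.
    move=> i; rewrite map_inj_uniq; first by case: (hL i).
    by move=> y z /finj[].
  by move=> i j x /mapP[y _ ->] /mapP[z _ /finj[]].
- move=> x; apply/flattenP/eqP => [[l /mapP[i _ ->] /mapP[y hy ->]]|h].
    by move: hy; have [_ -> _] := hL i => /eqP.
  have [i [y hy]] := fsurj x; exists [seq f i y | y <- L i].
    by apply: (map_f (fun i => [seq f i y | y <- L i])); rewrite mem_enum.
  by rewrite -hy; apply: map_f; have [_ -> _] := hL i; rewrite hy h.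
- rewrite coefs_sum size_flatten /shape -map_comp sumnE big_map natr_sum.
  rewrite big_enum /=; apply: eq_bigr => i _.
  by rewrite size_map; case: (hL i).
Qed.

(** Restricts the sum to the image of the injection [f], which is recognised by [f (g x) == x]. The
    existence of a series is enough for [phi_Omega_odd], where only equality of the series of three
    classes matters. *)
Lemma gens_pull (T T' : eqType) (f : T' -> T) (g : T -> T') (e : T -> int) p :
  cancel f g -> gens e p -> exists r, gens (fun y => e (f y)) r.
Proof.
move=> fK [e0 hp]; have [L hL] := choice hp.
exists (Series (fun k => (size [seq g x | x <- L k & f (g x) == x])%:R)).
split=> [y|k]; first exact: e0.
exists [seq g x | x <- L k & f (g x) == x]; split=> // [|y].
  rewrite map_inj_in_uniq; first by apply: filter_uniq; case: (hL k).
  move=> x y; rewrite !mem_filter => /andP[/eqP hx _] /andP[/eqP hy _] h.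
  by rewrite -hx -hy h.
apply/mapP/idP => [[x]|h].
  rewrite mem_filter => /andP[/eqP hx hk] ->; rewrite hx.
  by move: hk; have [_ -> _] := hL k.
by exists (f y); rewrite ?fK // mem_filter fK eqxx /=; have [_ -> _] := hL k.
Qed.

Lemma gens_shift (T : eqType) (e : T -> int) p n :
  gens e p -> gens (fun x => e x + n%:Z) (q ^+ n * p).
Proof.
move=> [e0 hp]; split=> [x|k]; first exact: addr_ge0.
rewrite coefs_qnM; case: ifP => h.
  exists [::]; split=> // x; rewrite in_nil; apply/esym/eqP.
  by have := e0 x; lia.
have [L [uL mL ->]] := hp (k - n)%N; exists L; split=> // x.
by rewrite mL; apply/eqP/eqP; lia.
Qed.

Lemma gens_subs (T : eqType) (e : T -> int) p d : (0 < d)%N ->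
  gens e p -> gens (fun x => d%:Z * e x) (subs d p).
Proof.
move=> d0 [e0 hp]; split=> [x|k]; first exact: mulr_ge0.
case: (boolP (d %| k)%N) => [/dvdnP[m ->]|h].
  rewrite mulnC subs_mul //; have [L [uL mL ->]] := hp m; exists L; split=> // x.
  by rewrite mL PoszM; apply/eqP/eqP => [->//|]; apply: mulfI; lia.
rewrite subs_ndvd //; exists [::]; split=> // x; rewrite in_nil; apply/esym.
apply: contraNF h => /eqP h; apply/dvdnP; exists `|e x|%N.
by have := e0 x; nia.
Qed.

Lemma gens_coef0 (T : eqType) (e : T -> int) p (k : nat) :
  gens e p -> (forall x, e x <> k) -> p k = 0.
Proof.
move=> [_ hp] h; have [[|x L] [_ mL ->]] := hp k; first by [].
by case: (h x); apply/eqP; rewrite -mL mem_head.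
Qed.

Definition box (n : nat) : seq int := [seq i%:Z - n%:Z | i <- iota 0 n.*2.+1].

Lemma mem_box n x : (x \in box n) = (`|x| <= n%:Z).
Proof.
apply/mapP/idP => [[i]|h]; first by rewrite mem_iota => ? ->; lia.
by exists `|(x + n%:Z)%R|%N; rewrite ?mem_iota; lia.
Qed.

Lemma box_uniq n : uniq (box n).
Proof. by rewrite map_inj_uniq ?iota_uniq // => i j; lia. Qed.

(* The sum of q ^ (e x) over the integers, provided |x| <= e x + 1. *)
Definition theta (e : int -> int) : series int :=
  Series (fun k => (size [seq x <- box k.+1 | e x == k%:Z])%:R).

Lemma gens_theta (e : int -> int) :
  (forall x, 0 <= e x) -> (forall x, `|x| <= e x + 1) -> gens e (theta e).
Proof.
move=> e0 e1; split=> // k; exists [seq x <- box k.+1 | e x == k%:Z].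
split=> // [|x]; first exact: filter_uniq (box_uniq _).
by rewrite mem_filter mem_box andb_idr // => /eqP; have := e1 x; lia.
Qed.

Lemma int_mod2 (n : int) : exists m, n = 2 * m \/ n = 2 * m + 1.
Proof.
exists (n %/ 2)%Z; have := divz_eq n 2.
have := modz_ge0 n (isT : 2 != 0 :> int); have := ltz_pmod n (isT : 0 < 2 :> int).
by lia.
Qed.

Lemma int_mod3 (n : int) :
  exists m, [\/ n = 3 * m, n = 3 * m + 1 | n = 3 * m + 2].
Proof.
exists (n %/ 3)%Z; have := divz_eq n 3.
have := modz_ge0 n (isT : 3 != 0 :> int); have := ltz_pmod n (isT : 0 < 3 :> int).
move: (n %/ 3)%Z (n %% 3)%Z => m r ? ? ?.
have [?|[?|?]] : r = 0 \/ r = 1 \/ r = 2 by lia.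
- by apply: Or31; lia.
- by apply: Or32; lia.
- by apply: Or33; lia.
Qed.

(** * The theta series in use and the identities between them *)

Definition tri (n : int) : int := (n * (n + 1) %/ 2)%Z.

Lemma triE n : 2 * tri n = n * (n + 1).
Proof.
rewrite /tri mulrC divzK //; apply/dvdzP.
by have [m [->|->]] := int_mod2 n;
  [exists (m * (2 * m + 1)) | exists ((2 * m + 1) * (m + 1))]; ring.
Qed.

Definition phi : series int := theta (fun n => n ^+ 2).
Definition psi : series int := theta (fun n => 2 * n ^+ 2 + n).
(** As [tri n = tri (- 1 - n)], every triangular number occurs twice here and once in [psi]. Having
    all of Z as index set with exponent [tri] makes lattice splittings easy to write. *)
Definition Psi : series int := theta tri.
Definition Omega : series int := theta (fun n => 3 * n ^+ 2 + 2 * n).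
(** The exponents n (3 n + 1) / 2 are the generalized pentagonal numbers. *)
Definition alpha : series int := theta (fun n => tri n + n ^+ 2).

Lemma gens_phi : gens (fun n => n ^+ 2) phi.
Proof. by apply: gens_theta => x; nia. Qed.
Lemma gens_psi : gens (fun n => 2 * n ^+ 2 + n) psi.
Proof. by apply: gens_theta => x; nia. Qed.
Lemma gens_Psi : gens tri Psi.
Proof. by apply: gens_theta => x; have := triE x; nia. Qed.
Lemma gens_Omega : gens (fun n => 3 * n ^+ 2 + 2 * n) Omega.
Proof. by apply: gens_theta => x; nia. Qed.
Lemma gens_alpha : gens (fun n => tri n + n ^+ 2) alpha.
Proof. by apply: gens_theta => x; have := triE x; nia. Qed.

Lemma series_muln_inj m (p r : series int) : (0 < m)%N -> p *+ m = r *+ m -> p = r.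
Proof.
move=> m0 h; apply: seriesP => k.
have := congr1 (fun s : series int => s k) h.
by rewrite !coefs_muln => /eqP; rewrite eqrMn2r eqn0Ngt m0 => /eqP.
Qed.

(** Multiples of 3 give 9 y^2; the two other classes, written as 3 y + 1 and its negative, both give
    1 + 3 (3 y^2 + 2 y). *)
Lemma phi_dissection : phi = subs 3 (subs 3 phi) + q * subs 3 Omega *+ 2.
Proof.
pose f (i : 'I_3) (y : int) : int :=
  match val i with 0%N => 3 * y | 1%N => 3 * y + 1 | _ => - (3 * y + 1) end.
pose p (i : 'I_3) : series int :=
  match val i with 0%N => subs 3 (subs 3 phi) | _ => q ^+ 1 * subs 3 Omega end.
rewrite [LHS](gens_uniq gens_phi (@gens_cover _ _ _ f _ p _ _ _)).
- by rewrite !big_ord_recl big_ord0 /p /= addr0 expr1 mulr2n addrA.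
- move=> x; have [m [->|->|->]] := int_mod3 x.
  + by exists 0, m.
  + by exists 1, m.
  + by exists 2, (- m - 1); rewrite /f /=; lia.
- move=> [[|[|[|//]]] hi] [[|[|[|//]]] hj] y z; rewrite /f /= => h; split; try lia;
    apply: val_inj => /=; lia.
- case=> [[|[|[|//]]] hi]; rewrite /p /f /=.
  + by apply: gens_ext (gens_subs _ (gens_subs _ gens_phi)) _ => // x; lia.
  + by apply: gens_ext (gens_shift 1 (gens_subs _ gens_Omega)) _ => // x; lia.
  + by apply: gens_ext (gens_shift 1 (gens_subs _ gens_Omega)) _ => // x; lia.
Qed.

(** The even indices and their reflections under n -> - 1 - n, which are the odd ones, carry the
    same triangular numbers. *)
Lemma Psi_psi : Psi = psi *+ 2.
Proof.
pose f (i : bool) (y : int) : int := if i then 2 * y else - 1 - 2 * y.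
rewrite (gens_uniq gens_Psi (@gens_cover _ _ _ f _ (fun=> psi) _ _ _)).
- by rewrite sumr_const card_bool.
- move=> x; have [m [->|->]] := int_mod2 x; first by exists true, m.
  by exists false, (- m - 1); rewrite /f; lia.
- by move=> [] [] y z; rewrite /f => h; split=> //; lia.
- case; apply: gens_ext gens_psi _ => y /=.
    by have := triE (2 * y); lia.
  by have := triE (- 1 - 2 * y); lia.
Qed.

(** Proved for [Psi] and halved: 3 y and its reflection - 1 - 3 y give three times a pentagonal
    number, while [tri (3 * y + 1) = 9 * tri y + 1]. *)
Lemma psi_dissection : psi = subs 3 alpha + q * subs 3 (subs 3 psi).
Proof.
suff h : Psi = subs 3 alpha *+ 2 + q * subs 3 (subs 3 Psi).
  apply: (@series_muln_inj 2) => //; rewrite -Psi_psi h Psi_psi !subs_muln //.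
  by rewrite mulrnAr mulrnDl.
pose f (i : 'I_3) (y : int) : int :=
  match val i with 0%N => 3 * y | 1%N => - 1 - 3 * y | _ => 3 * y + 1 end.
pose p (i : 'I_3) : series int :=
  match val i with 2%N => q ^+ 1 * subs 3 (subs 3 Psi) | _ => subs 3 alpha end.
rewrite [LHS](gens_uniq gens_Psi (@gens_cover _ _ _ f _ p _ _ _)).
- by rewrite !big_ord_recl big_ord0 /p /= addr0 expr1 mulr2n addrA.
- move=> x; have [m [->|->|->]] := int_mod3 x.
  + by exists 0, m.
  + by exists 2, m.
  + by exists 1, (- m - 1); rewrite /f /=; lia.
- move=> [[|[|[|//]]] hi] [[|[|[|//]]] hj] y z; rewrite /f /= => h; split; try lia;
    apply: val_inj => /=; lia.
- case=> [[|[|[|//]]] hi]; rewrite /p /f /=.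
  + apply: gens_ext (gens_subs _ gens_alpha) _ => // x.
    by have := triE x; have := triE (3 * x); lia.
  + apply: gens_ext (gens_subs _ gens_alpha) _ => // x.
    by have := triE x; have := triE (- 1 - 3 * x); lia.
  + apply: gens_ext (gens_shift 1 (gens_subs _ (gens_subs _ gens_Psi))) _ => // x.
    by have := triE x; have := triE (3 * x + 1); lia.
Qed.

(* Writing u = 2x+1, v = 2y+1, the three cosets of (x, y) are: u + v sqrt(-2)
   divisible by 1 + sqrt(-2), and, up to sign, the quotients of elements
   (6i+1) + 2(3j+1) sqrt(-2) by 1 - sqrt(-2). *)
Lemma Psi_Psi2 : Psi * subs 2 Psi = (alpha * Omega) *+ 2 + subs 3 Psi * subs 3 phi.
Proof.
pose f (i : 'I_3) (y : int * int) : int * int :=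
  match val i with
  | 0%N => (y.1 - 2 * y.2 - 1, y.1 + y.2)
  | 1%N => (2 * y.2 - y.1, - 1 - y.1 - y.2)
  | _ => (y.1 - 2 * y.2, y.1 + y.2)
  end.
pose p (i : 'I_3) : series int :=
  match val i with 2%N => subs 3 Psi * subs 3 phi | _ => alpha * Omega end.
have g := gens_mul gens_Psi (gens_subs (isT : 0 < 2)%N gens_Psi).
rewrite [LHS](gens_uniq g (@gens_cover _ _ _ f _ p _ _ _)).
- by rewrite !big_ord_recl big_ord0 /p /= addr0 mulr2n addrA.
- case=> x y; have [m h] := int_mod3 (x - y).
  case: h => h.
  + by exists 2, (y + m, - m); rewrite /f /=; congr pair; lia.
  + by exists 1, (- 1 - y - m, m); rewrite /f /=; congr pair; lia.
  + by exists 0, (y + m + 1, - m - 1); rewrite /f /=; congr pair; lia.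
- move=> [[|[|[|//]]] hi] [[|[|[|//]]] hj] [y1 y2] [z1 z2];
    rewrite /f /= => -[h1 h2]; split;
    try (congr pair; lia); apply: val_inj => /=; lia.
- case=> [[|[|[|//]]] hi]; rewrite /p /f /=.
  + apply: gens_ext (gens_mul gens_alpha gens_Omega) _ => // -[i j] /=.
    by have := triE i; have := triE (i - 2 * j - 1); have := triE (i + j); lia.
  + apply: gens_ext (gens_mul gens_alpha gens_Omega) _ => // -[i j] /=.
    by have := triE i; have := triE (2 * j - i); have := triE (- 1 - i - j); lia.
  + apply: gens_ext (gens_mul (gens_subs _ gens_Psi) (gens_subs _ gens_phi)) _ =>
    // -[i j] /=.
    by have := triE i; have := triE (i - 2 * j); have := triE (i + j); lia.
Qed.

(** If x and y have the same parity, x = j + i and y = j - i give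
    [tri x + tri y = i ^+ 2 + 2 * tri j]. The reflection y -> - 1 - y carries the opposite parity
    case to this one. *)
Lemma Psi_sqr : Psi * Psi = (phi * subs 2 Psi) *+ 2.
Proof.
pose f (i : bool) (y : int * int) : int * int :=
  if i then (y.2 + y.1, y.2 - y.1) else (y.2 + y.1, - 1 - y.2 + y.1).
rewrite (gens_uniq (gens_mul gens_Psi gens_Psi)
  (@gens_cover _ _ _ f _ (fun=> phi * subs 2 Psi) _ _ _)).
- by rewrite sumr_const card_bool.
- case=> x y; have [m [h|h]] := int_mod2 (x - y).
    by exists true, (m, y + m); rewrite /f /=; congr pair; lia.
  by exists false, (y + m + 1, m); rewrite /f /=; congr pair; lia.
- move=> [] [] [y1 y2] [z1 z2]; rewrite /f /= => -[h1 h2]; split;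
    try (congr pair; lia); lia.
- case; apply: gens_ext (gens_mul gens_phi (gens_subs _ gens_Psi)) _ => // -[i j] /=.
    by have := triE j; have := triE (j - i); have := triE (j + i); lia.
  by have := triE j; have := triE (- 1 - j + i); have := triE (j + i); lia.
Qed.

Lemma psi_psi2 : psi * subs 2 psi *+ 2 = alpha * Omega + subs 3 psi * subs 3 phi.
Proof.
apply: (@series_muln_inj 2) => //.
have := Psi_Psi2; rewrite Psi_psi !subs_muln // => h.
transitivity (psi *+ 2 * (subs 2 psi *+ 2)); first by ring.
rewrite h; ring.
Qed.

Lemma psi_sqr : psi * psi = phi * subs 2 psi.
Proof.
apply: (@series_muln_inj 4) => //.
have := Psi_sqr; rewrite Psi_psi !subs_muln // => h.
transitivity (psi *+ 2 * (psi *+ 2)); first by ring.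
rewrite h; ring.
Qed.

(* On (3 n + 1) + x * sqrt(-3) with x = n + 1 mod 2, multiplication by a
   primitive cube root of unity acts without fixed points; it permutes
   cyclically the three classes below. *)
Lemma phi_Omega_odd (k : nat) : odd k -> (3 %| ((phi * Omega) k))%Z.
Proof.
move=> ok.
pose f (i : 'I_4) (y : int * int) : int * int :=
  let: (n, j) := y in
  match val i with
  | 0%N => (n + 2 * j, n)
  | 1%N => (6 * j + 1 - 3 * n, n)
  | 2%N => (3 * n - 3 * j, n - 3 * j - 1)
  | _ => (- 3 * j - 1, 3 * j - 2 * n)
  end.
have g := gens_mul gens_phi gens_Omega.
have [r0 hr0] : exists r, gens (fun y : int * int => (f 0 y).1 ^+ 2
  + (3 * (f 0 y).2 ^+ 2 + 2 * (f 0 y).2)) r.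
  (* Only a left inverse of [f 0] is required, so it suffices that the division is exact on the
     image. *)
  apply: (gens_pull (g := fun z => (z.2, ((z.1 - z.2) %/ 2)%Z)) _ g).
  by case=> n j; rewrite /f /=; congr pair; rewrite addrC addKr mulKz.
have [r1 hr1] : exists r, gens (fun y : int * int => (f 1 y).1 ^+ 2
  + (3 * (f 1 y).2 ^+ 2 + 2 * (f 1 y).2)) r.
  apply: (gens_pull (g := fun z => (z.2, ((z.1 - 1 + 3 * z.2) %/ 6)%Z)) _ g).
  case=> n j; rewrite /f /=; congr pair.
  by rewrite (_ : 6 * j + 1 - 3 * n - 1 + 3 * n = 6 * j) ?mulKz //; ring.
pose p (i : 'I_4) : series int := if val i is 0%N then r0 else r1.
rewrite (gens_uniq g (@gens_cover _ _ _ f _ p _ _ _)).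
- rewrite !big_ord_recl big_ord0 /p !coefs_add coefs0 /=.
  (* Class 0 consists of the pairs of equal parity; its exponent 4 n^2 + 4 n j + 4 j^2 + 2 n is
     even, so it contributes nothing to an odd [k]. *)
  rewrite (gens_coef0 hr0) => [|[n j] /=]; last lia.
  by rewrite (_ : 0 + _ = 3 * r1 k) ?dvdz_mulr //; ring.
- case=> x n; have [t [h|h]] := int_mod2 (x + n).
    by exists 0, (n, t - n); rewrite /f /=; congr pair; lia.
  (* With x + n = 2 t + 1, the three classes permuted by the cube root of unity are told apart by n
     + t modulo 3. *)
  have [j [e|e|e]] := int_mod3 (n + t).
  + by exists 1, (n, j); rewrite /f /=; congr pair; lia.
  + by exists 2, (t - n, j - n); rewrite /f /=; congr pair; lia.
  + by exists 3, (- t - 1, j - t); rewrite /f /=; congr pair; lia.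
- move=> [[|[|[|[|//]]]] hi] [[|[|[|[|//]]]] hj] [y1 y2] [z1 z2];
    rewrite /f /= => -[h1 h2]; split;
    try (congr pair; lia); try lia; apply: val_inj => /=; lia.
- case=> [[|[|[|[|//]]]] hi]; rewrite /p /=.
  + by apply: gens_ext hr0 _ => -[].
  + by apply: gens_ext hr1 _ => -[].
  + by apply: gens_ext hr1 _ => -[n j] /=; ring.
  + by apply: gens_ext hr1 _ => -[n j] /=; ring.
Qed.

(** * The progression 3k+2 *)

(** By [phi_dissection], phi = a + 2 b with a = phi(q^9) and b = q Omega(q^3). Multiplying by a^2 -
    2 a b + 4 b^2 turns it into a^3 + 8 b^3, a series in q^3, which [disM] takes out of the
    dissection. Then [psi_psi2] eliminates [alpha]. *)
Lemma dis_quotient (H : series int) :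
  H * phi * subs 3 (subs 3 psi) = psi * subs 3 (subs 3 phi) ->
  dis 3 2 H * ((subs 3 phi ^+ 3 + q * Omega ^+ 3 *+ 8) * subs 3 psi) =
  subs 3 phi * Omega * (psi * subs 2 psi *+ 8 - subs 3 psi * subs 3 phi *+ 6).
Proof.
move=> hH.
pose f := subs 3 phi; pose g := subs 3 psi.
have s1 : subs 3 (q : series int) = q ^+ 3 by rewrite -[q in LHS]expr1 subs_q.
rewrite -disM.
(* The three components of psi phi(q^9) (a^2 - 2 a b + 4 b^2), with psi expanded by
   [psi_dissection]; only [U2] survives. *)
pose U0 := f * (alpha * f ^+ 2 + q * g * Omega ^+ 2 *+ 4).
pose U1 := f * (g * f ^+ 2 - alpha * f * Omega *+ 2).
pose U2 := f * (alpha * Omega ^+ 2 *+ 4 - g * f * Omega *+ 2).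
transitivity (dis 3 2 (subs 3 U0 + q * subs 3 U1 + q ^+ 2 * subs 3 U2)).
  congr (dis 3 2 _); rewrite /U0 /U1 /U2 !(subsM, subsD, subsN, subsX,
    subs_muln) // s1 -/f -/g.
  transitivity (H * phi * subs 3 g * (subs 3 f ^+ 2 - q * subs 3 f * subs 3 Omega *+ 2
     + q ^+ 2 * subs 3 Omega ^+ 2 *+ 4)).
    have := phi_dissection; rewrite -/f => ->; ring.
  rewrite hH; have := psi_dissection; rewrite -/f -/g => ->; ring.
rewrite dis_subs /U2.
transitivity (f * Omega * (alpha * Omega *+ 4 - g * f *+ 2)); first by ring.
congr (_ * _).
have e : alpha * Omega = psi * subs 2 psi *+ 2 - g * f.
  by rewrite psi_psi2 addrK.
rewrite e -/f -/g; ring.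
Qed.

(** * Congruences between power series *)

Definition sdvd (m : nat) (p : series int) := forall k, (m %| p k)%Z.

Lemma sdvdP m p : sdvd m p <-> exists r : series int, p = r *+ m.
Proof.
split=> [h|[r -> k]].
  exists (Series (fun k => (p k %/ m)%Z)); apply: seriesP => k.
  by rewrite coefs_muln /= -mulr_natr natz divzK.
by rewrite coefs_muln -mulr_natr natz dvdz_mull.
Qed.

(** A series with constant term 1 is invertible, hence cancellable modulo any [m]; here by strong
    induction on the coefficient. *)
Lemma sdvd_cancel m (p u : series int) : u 0%N = 1 -> sdvd m (p * u) -> sdvd m p.
Proof.
move=> u0 h k; have [n] := ubnP k; elim: n k => // n IH k kn.
have := h k; rewrite coefs_mul big_ord_recr /= subnn u0 mulr1 rpredDl //.
by apply: rpred_sum => -[i hi] _ /=; apply: dvdz_mulr; apply: IH; lia.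
Qed.

(** Horner induction: the cube is additive modulo 3, and c^3 = c modulo 3 for an integer c. *)
Lemma frobenius3_poly (P : {poly int}) :
  exists R, P ^+ 3 = P \Po 'X^3 + R *+ 3.
Proof.
elim/poly_ind: P => [|P c [R IH]]; first by exists 0; rewrite comp_poly0; ring.
have [d hd] : exists d, c ^+ 3 = c + d *+ 3.
  have [m [->|->|->]] := int_mod3 c.
  - by exists (9 * m ^+ 3 - m); ring.
  - by exists (9 * m ^+ 3 + 9 * m ^+ 2 + 2 * m); ring.
  - by exists (9 * m ^+ 3 + 18 * m ^+ 2 + 11 * m + 2); ring.
exists (R * 'X^3 + P ^+ 2 * 'X^2 * c%:P + P * 'X * c%:P ^+ 2 + d%:P).
have hd' : c%:P ^+ 3 = c%:P + d%:P *+ 3 :> {poly int}.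
  by rewrite -polyCMn -polyCD -hd polyC_exp.
rewrite comp_polyD comp_polyM comp_polyX comp_polyC.
transitivity (P ^+ 3 * 'X^3 + (P ^+ 2 * 'X^2 * c%:P + P * 'X * c%:P ^+ 2) *+ 3
  + c%:P ^+ 3).
  by ring.
rewrite IH hd'; ring.
Qed.

Lemma frobenius3 (p : series int) : exists r, p ^+ 3 = subs 3 p + r *+ 3.
Proof.
suff /sdvdP[r hr] : sdvd 3 (p ^+ 3 - subs 3 p) by exists r; rewrite -hr addrC subrK.
move=> k; have [R hR] := frobenius3_poly (trunc k.+1 p).
have h i : (i < k.+1)%N -> (trunc k.+1 p ^+ 2)`_i = (p ^+ 2) i.
  move=> ik; rewrite !expr2 [RHS](smul_trunc _ _ ik); exact: coef_mul_eq.
have -> : (p ^+ 3 - subs 3 p) k = R`_k *+ 3.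
  rewrite coefs_add coefs_opp (subs_trunc _ _ (leqnn k.+1)) //.
  rewrite exprS (smul_trunc _ _ (leqnn k.+1)).
  rewrite (@coef_mul_eq _ k.+1 _ (trunc k.+1 p) _ (trunc k.+1 p ^+ 2)) //; last first.
    by move=> i ik; rewrite h // coef_trunc.
  by rewrite -exprS hR coefD coefMn addrC addKr.
by rewrite -mulr_natr dvdz_mull.
Qed.

Lemma mul_coef0 (p r : series int) : (p * r) 0%N = p 0%N * r 0%N.
Proof. by rewrite coefs_mul big_ord1. Qed.

Lemma exp_coef0 (p : series int) n : (p ^+ n) 0%N = p 0%N ^+ n.
Proof.
by elim: n => [|n IH]; rewrite ?expr0 ?coefs1 // !exprS mul_coef0 IH.
Qed.

Lemma phi0 : phi 0%N = 1. Proof. by []. Qed.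

(** Modulo 2, [phi_dissection] says phi(q) = phi(q^9), so a coefficient of positive index is even or
    is reduced to one of smaller positive index. *)
Lemma phi_even : exists t, phi = 1 + t *+ 2.
Proof.
suff /sdvdP[t ht] : sdvd 2 (phi - 1) by exists t; rewrite -ht addrC subrK.
move=> k; have [n] := ubnP k; elim: n k => // n IH [|k] kn.
  by rewrite coefs_add coefs_opp coefs1 phi0.
rewrite coefs_add coefs_opp coefs1 subr0 phi_dissection coefs_add coefs_muln.
rewrite rpredDr; last by rewrite -mulr_natr dvdz_mull.
rewrite /=; case: ifP => // h3; case: ifP => // h9.
have := IH (k.+1 %/ 3 %/ 3)%N.
rewrite coefs_add coefs_opp coefs1 (_ : (_ == _) = false) ?subr0; last lia.
by apply; lia.
Qed.

(** Modulo 8, [dis_quotient] reads H2 f^3 g = - 6 f^2 Omega g. Subtracting 2 Omega f times f^3 g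
    leaves - 2 Omega g f^2 (3 + f^2), and f = 1 + 2 t makes 3 + f^2 divisible by 4. *)
Lemma dis_quotient_mod8 (H : series int) :
  H * phi * subs 3 (subs 3 psi) = psi * subs 3 (subs 3 phi) ->
  sdvd 8 (dis 3 2 H - Omega * subs 3 phi *+ 2).
Proof.
move=> /dis_quotient; set H2 := dis 3 2 H; set f := subs 3 phi;
  set g := subs 3 psi => h.
have [t ht] : exists t, f = 1 + t *+ 2.
  have [t ht] := phi_even; exists (subs 3 t).
  by rewrite /f {1}ht subsD subs_muln // subs1.
apply: (@sdvd_cancel _ _ (f ^+ 3 * g)).
  by rewrite mul_coef0 exp_coef0.
apply/sdvdP.
exists (f * Omega * psi * subs 2 psi - Omega * g * f ^+ 2 * (1 + t
  + t ^+ 2) - H2 * q * Omega ^+ 3 * g).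
transitivity (H2 * ((f ^+ 3 + q * Omega ^+ 3 *+ 8) * g) - H2 * q * Omega ^+ 3 * g *+ 8
  - Omega * f ^+ 4 * g *+ 2); first by ring.
rewrite h.
transitivity ((f * Omega * psi * subs 2 psi - H2 * q * Omega ^+ 3 * g) *+ 8
  - Omega * g * f ^+ 2 * (3 + f ^+ 2) *+ 2); first by ring.
have -> : 3 + f ^+ 2 = (1 + t + t ^+ 2) *+ 4 by rewrite ht; ring.
ring.
Qed.

(** Modulo 3, f^3 + 8 q Omega^3 is phi, f is phi^3 and g is psi^3. So [dis_quotient] becomes H2 phi
    psi^3 = 8 phi^3 Omega psi psi(q^2), which is - phi^2 Omega psi^3 by [psi_sqr]; cancel phi
    psi^3. *)
Lemma dis_quotient_mod3 (H : series int) :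
  H * phi * subs 3 (subs 3 psi) = psi * subs 3 (subs 3 phi) ->
  sdvd 3 (dis 3 2 H + phi * Omega).
Proof.
move=> /dis_quotient; set H2 := dis 3 2 H; set f := subs 3 phi;
  set g := subs 3 psi => h.
have [a ha] : exists a, f ^+ 3 + q * Omega ^+ 3 *+ 8 = phi + a *+ 3.
  suff /sdvdP[a e] : sdvd 3 (f ^+ 3 + q * Omega ^+ 3 *+ 8 - phi).
    by exists a; rewrite -e; ring.
  have [b hb] := frobenius3 phi.
  (* After q -> q^3 the first two terms are the cube of phi modulo 3, by [phi_dissection], and
     Frobenius compares this cube with phi(q^3). *)
  have : sdvd 3 (subs 3 (f ^+ 3 + q * Omega ^+ 3 *+ 8 - phi)).
    apply/sdvdP.
    exists (b - subs 3 f ^+ 2 * q * subs 3 Omega *+ 2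
      - subs 3 f * q ^+ 2 * subs 3 Omega ^+ 2 *+ 4).
    have s1 : subs 3 (q : series int) = q ^+ 3 by rewrite -[q in LHS]expr1 subs_q.
    rewrite !(subsM, subsD, subsN, subsX, subs_muln) // s1 -/f.
    transitivity ((subs 3 f + q * subs 3 Omega *+ 2) ^+ 3 - f
       - (subs 3 f ^+ 2 * q * subs 3 Omega *+ 2
           + subs 3 f * q ^+ 2 * subs 3 Omega ^+ 2 *+ 4) *+ 3).
      by ring.
    rewrite -phi_dissection hb -/f; ring.
  by move=> hk k; have := hk (3 * k)%N; rewrite subs_mul.
have [b hb] := frobenius3 phi; have [c hc] := frobenius3 psi.
rewrite -/f in hb; rewrite -/g in hc.
apply: (@sdvd_cancel _ _ (phi * psi ^+ 3)).
  by rewrite mul_coef0 exp_coef0.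
have hf : f = phi ^+ 3 - b *+ 3 by rewrite hb; ring.
have hg : g = psi ^+ 3 - c *+ 3 by rewrite hc; ring.
apply/sdvdP; rewrite ha in h.
exists (H2 * phi * c - H2 * a * g
  + phi ^+ 2 * Omega * psi ^+ 3 *+ 3 - b * Omega * psi * subs 2 psi *+ 8
    - f * Omega * g * f *+ 2).
transitivity (H2 * ((phi + a *+ 3) * g)
  + H2 * phi * (psi ^+ 3 - g) - H2 * a * g *+ 3 + phi ^+ 2 * Omega * psi ^+ 3).
  by ring.
rewrite h {1}hc.
transitivity (phi ^+ 2 * Omega * psi * (phi * subs 2 psi) *+ 8
  + phi ^+ 2 * Omega * psi ^+ 3 +
  (H2 * phi * c - H2 * a * g - b * Omega * psi * subs 2 psi *+ 8
    - f * Omega * g * f *+ 2) *+ 3).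
  have -> : f * Omega * (psi * subs 2 psi *+ 8 - g * f *+ 6) =
      (phi ^+ 3 - b *+ 3) * Omega * psi * subs 2 psi *+ 8 - f * Omega * g * f *+ 6.
    by rewrite -hf; ring.
  ring.
rewrite -psi_sqr; ring.
Qed.

(** * The triple product *)

(** Gaussian binomial coefficients, by a Pascal rule so as to avoid division in [R]. *)
Fixpoint gbinom (R : comNzRingType) (w : R) (m k : nat) : R :=
  match m, k with
  | _, 0%N => 1
  | 0%N, _.+1 => 0
  | m'.+1, k'.+1 => gbinom w m' k' + w ^+ k * gbinom w m' k
  end.

Definition poch (R : comNzRingType) (w : R) (m : nat) : R :=
  \prod_(i < m) (1 - w ^+ i.+1).

Lemma gbinomn0 (R : comNzRingType) (w : R) m : gbinom w m 0 = 1.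
Proof. by case: m. Qed.

Lemma gbinomS (R : comNzRingType) (w : R) m k :
  gbinom w m.+1 k.+1 = gbinom w m k + w ^+ k.+1 * gbinom w m k.+1.
Proof. by []. Qed.

Lemma gbinom_small (R : comNzRingType) (w : R) m k : (m < k)%N -> gbinom w m k = 0.
Proof.
elim: m k => [|m IH] [|k] //= mk.
by rewrite !IH ?mulr0 ?addr0 //; lia.
Qed.

(** The mirror Pascal rule, deduced from the defining one by induction. *)
Lemma gbinomSr (R : comNzRingType) (w : R) m k : (k <= m)%N ->
  gbinom w m.+1 k.+1 = gbinom w m k.+1 + w ^+ (m - k) * gbinom w m k.
Proof.
elim: m k => [|m IH] k km.
  by rewrite (_ : k = 0%N) /=; [ring | lia].
rewrite gbinomS; case: k km => [|k] km.
  have e := IH 0%N isT; rewrite subn0 gbinomn0 mulr1 in e.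
  by rewrite subn0 !gbinomn0 {1}e gbinomS gbinomn0 !exprS; ring.
case: (ltnP k m) => hk.
  rewrite {1}(IH k) // {1}(IH k.+1) // [in RHS]gbinomS [in RHS](gbinomS _ m k) subSS.
  have -> : w ^+ (m - k) = w * w ^+ (m - k.+1) by rewrite -exprS; congr (_ ^+ _); lia.
  rewrite !exprS; ring.
have -> : k = m by lia.
by rewrite [gbinom w m.+1 m.+2]gbinom_small // subnn; ring.
Qed.

Lemma pochS (R : comNzRingType) (w : R) m : poch w m.+1 = poch w m * (1 - w ^+ m.+1).
Proof. by rewrite /poch big_ord_recr. Qed.

(** The quotient formula for Gaussian binomials with denominators cleared; apply the Pascal rule and
    split [1 - w ^+ m.+1] as (1 - w^(k+1)) + w^(k+1) (1 - w^(m-k)). *)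
Lemma gbinom_poch (R : comNzRingType) (w : R) m k : (k <= m)%N ->
  gbinom w m k * poch w k * poch w (m - k) = poch w m.
Proof.
elim: m k => [|m IH] [|k] km; rewrite ?gbinomn0 ?subn0 /poch ?big_ord0 ?mul1r ?mulr1 //.
rewrite -!/(poch _ _) gbinomS subSS.
case: (ltnP k m) => hk; last first.
  have e : k = m by lia.
  have h := IH m (leqnn _); rewrite e [gbinom w m m.+1]gbinom_small // pochS -{2}h;
    ring.
transitivity (gbinom w m k * poch w k * poch w (m - k) * (1 - w ^+ k.+1) +
  gbinom w m k.+1 * poch w k.+1 * poch w (m - k.+1) * w ^+ k.+1 * (1 - w ^+ (m - k))).
  rewrite (_ : (m - k = (m - k.+1).+1)%N) ?pochS; last lia.
  ring.
rewrite !IH // pochS.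
rewrite (_ : w ^+ m.+1 = w ^+ k.+1 * w ^+ (m - k)); first ring.
by rewrite -exprD; congr (_ ^+ _); lia.
Qed.

Lemma gbinom_sumS (R : comNzRingType) (w : R) m (Y : nat -> R) :
  \sum_(k < m.+2) gbinom w m.+1 k * Y k =
  \sum_(k < m.+1) gbinom w m k * Y k.+1 + \sum_(k < m.+1) w ^+ k * gbinom w m k * Y k.
Proof.
have -> : \sum_(k < m.+1) w ^+ k * gbinom w m k * Y k =
    \sum_(k < m.+2) w ^+ k * gbinom w m k * Y k.
  by rewrite [RHS]big_ord_recr /= gbinom_small // mulr0 mul0r addr0.
rewrite [LHS]big_ord_recl [\sum_(k < m.+2) _]big_ord_recl /= !gbinomn0 addrCA
  -big_split /=.
rewrite !mul1r; congr (_ + _).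
by apply: eq_bigr => k _; rewrite /bump /= add1n; ring.
Qed.

Lemma gbinom_sumSr (R : comNzRingType) (w : R) m (Y : nat -> R) :
  \sum_(k < m.+2) gbinom w m.+1 k * Y k =
  \sum_(k < m.+1) gbinom w m k * Y k
    + \sum_(k < m.+1) w ^+ (m - k) * gbinom w m k * Y k.+1.
Proof.
have -> : \sum_(k < m.+1) gbinom w m k * Y k = \sum_(k < m.+2) gbinom w m k * Y k.
  by rewrite [RHS]big_ord_recr /= gbinom_small // mul0r addr0.
rewrite [LHS]big_ord_recl [\sum_(k < m.+2) _]big_ord_recl /= !gbinomn0 -addrA
  -big_split /=.
congr (_ + _).
apply: eq_bigr => k _; rewrite /bump /= add1n.
by rewrite -[_ + _ * gbinom _ _ _]/(gbinom w m.+1 k.+1) gbinomSr; [ring | case: k].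
Qed.

Lemma triS n : tri (n + 1) = tri n + n + 1.
Proof. by have := triE n; have := triE (n + 1); lia. Qed.

Lemma tri_ge0 n : 0 <= tri n.
Proof. by have := triE n; nia. Qed.

Definition jmon (R : comNzRingType) (x y : R) (n : int) : R :=
  x ^+ `|tri n|%N * y ^+ `|tri (n - 1)|%N.

(** Factors are added one at a time. The new monomial times [jmon x y n] is a power of [x * y] times
    the neighbouring [jmon], at n - 1 for the factors counted by [b] and n + 1 for those counted by
    [a]; each case matches one Pascal rule. *)
Lemma finite_jacobi (R : comNzRingType) (x y : R) a b :
  \prod_(i < a) (1 + x ^+ i.+1 * y ^+ i) * \prod_(i < b) (1 + x ^+ i * y ^+ i.+1) =
  \sum_(k < (a + b).+1) gbinom (x * y) (a + b) k * jmon x y (k%:Z - b%:Z).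
Proof.
elim: a => [|a IHa].
  rewrite big_ord0 mul1r; elim: b => [|b IHb].
    by rewrite big_ord0 big_ord1 /jmon /= mul1r !expr0 mulr1.
  rewrite big_ord_recr /= IHb !add0n (gbinom_sumS _ _ (fun k => jmon x y (k%:Z
    - b.+1%:Z))).
  rewrite mulrDr mulr1 big_distrl /=; congr (_ + _); apply: eq_bigr => k _.
    by congr (_ * jmon _ _ _); lia.
  rewrite -[LHS]mulrA [(x * y) ^+ k * _]mulrC -[RHS]mulrA; congr (_ * _).
  have [n hn] : exists n : int, k%:Z - b%:Z = n by exists (k%:Z - b%:Z).
  rewrite exprMn /jmon hn (_ : k%:Z - b.+1%:Z = n - 1); last lia.
  have t1 := triS (n - 1); have t2 := triS (n - 1 - 1).
  have := tri_ge0 n; have := tri_ge0 (n - 1); have := tri_ge0 (n - 1 - 1).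
  rewrite !subrK in t1 t2; move=> g1 g2 g3.
  transitivity (x ^+ (`|tri n| + b) * y ^+ (`|tri (n - 1)| + b.+1));
    first by rewrite !exprD; ring.
  transitivity (x ^+ (k + `|tri (n - 1)|) * y ^+ (k + `|tri (n - 1 - 1)|));
    last by rewrite !exprD; ring.
  by congr (_ ^+ _ * _ ^+ _); lia.
rewrite big_ord_recr /= [_ * (1 + _)]mulrC -mulrA IHa addSn.
rewrite (gbinom_sumSr _ _ (fun k => jmon x y (k%:Z - b%:Z))).
rewrite mulrDl mul1r big_distrr /=; congr (_ + _); apply: eq_bigr => -[k hk] _ /=.
rewrite [(x * y) ^+ (a + b - k) * _]mulrC mulrCA -[RHS]mulrA; congr (_ * _).
have [n hn] : exists n : int, k%:Z - b%:Z = n by exists (k%:Z - b%:Z).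
rewrite exprMn /jmon hn (_ : k.+1%:Z - b%:Z = n + 1); last lia.
have t1 := triS n; have t2 := triS (n - 1).
have := tri_ge0 n; have := tri_ge0 (n - 1); have := tri_ge0 (n + 1).
rewrite addrK; rewrite !subrK in t2; move=> g1 g2 g3.
transitivity (x ^+ (`|tri n| + a.+1) * y ^+ (`|tri (n - 1)| + a));
  first by rewrite !exprD; ring.
transitivity (x ^+ ((a + b - k) + `|tri (n + 1)|) * y ^+ ((a + b - k) + `|tri n|));
  last by rewrite !exprD; ring.
move: t1 t2 g1 g2 g3; move: (tri n) (tri (n - 1)) (tri (n
  + 1)) => T0 T1 T2 t1 t2 g1 g2 g3.
by clear IHa; congr (_ ^+ _ * _ ^+ _); lia.
Qed.

(** * Power series modulo q^n, which give access to infinite products through finite ones *)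

Definition eqs (n : nat) (p r : series int) := forall k, (k < n)%N -> p k = r k.

Lemma eqs_mul n p p' r r' : eqs n p p' -> eqs n r r' -> eqs n (p * r) (p' * r').
Proof.
move=> hp hr k kn; rewrite !coefs_mul; apply: eq_bigr => -[i hi] _ /=.
by rewrite hp ?hr //; lia.
Qed.

Lemma eqs_trans n p r s : eqs n p r -> eqs n r s -> eqs n p s.
Proof. by move=> h1 h2 k kn; rewrite h1 // h2. Qed.

Lemma eqs_sym n p r : eqs n p r -> eqs n r p.
Proof. by move=> h k kn; rewrite h. Qed.

Lemma eqs_subs n d p r : (0 < d)%N -> eqs n p r -> eqs n (subs d p) (subs d r).
Proof.
move=> d0 h k kn /=; case: ifP => // _; apply: h.
by apply: leq_ltn_trans kn; rewrite leq_div.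
Qed.

Lemma eqs_cancel n (p r u : series int) : u 0%N =
  1 -> eqs n (p * u) (r * u) -> eqs n p r.
Proof.
move=> u0 h k; have [m] := ubnP k; elim: m k => // m IH k km kn.
have := h k kn; rewrite !coefs_mul !big_ord_recr /= subnn u0 !mulr1.
rewrite (eq_bigr (fun i : 'I_k => r i * u (k - i)%N)) => [/addrI//|[i hi] _ /=].
by rewrite IH //; lia.
Qed.

Lemma eqs_qn n m (p : series int) : (n <= m)%N -> eqs n (q ^+ m * p) 0.
Proof. by move=> nm k kn; rewrite coefs_qnM ifT //; lia. Qed.

Lemma poch_eqs d n m : (0 < d)%N -> (n <= m)%N ->
  eqs n (poch (q ^+ d) m) (poch (q ^+ d) n).
Proof.
move=> d0; elim: m => [|m IH] nm; first by rewrite (_ : n = 0%N) //; lia.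
case: (ltnP m n) => h; first by rewrite (_ : n = m.+1) //; lia.
apply: eqs_trans (IH h) => k kn.
rewrite pochS mulrBr mulr1 coefs_add coefs_opp -exprM [poch _ _ * _]mulrC.
by rewrite (@eqs_qn n) // ?subr0 //; nia.
Qed.

Lemma poch_coef0 d m : (0 < d)%N -> poch (q ^+ d : series int) m 0%N = 1.
Proof.
move=> d0; elim: m => [|m IH]; first by rewrite /poch big_ord0 coefs1.
rewrite pochS mul_coef0 IH coefs_add coefs_opp coefs1 -exprM coefs_qn.
by rewrite (_ : (0 == d * _)%N = false) //; nia.
Qed.

Lemma gens_box (e : int -> int) p N k : gens e p -> (forall x, `|x| <= e x + 1) ->
  (k < N)%N -> p k = (\sum_(j < N.*2.+1) q ^+ `|e (j%:Z - N%:Z)%R|%N : series int) k.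
Proof.
move=> [e0 hp] e1 kN; rewrite coefs_sum.
have [L [uL mL ->]] := hp k.
transitivity ((size [seq x <- box N | e x == k%:Z])%:R : int).
  congr (_%:R); apply/eqP; rewrite -uniq_size_uniq // ?filter_uniq ?box_uniq // => x.
  rewrite mL mem_filter mem_box andb_idr // => /eqP; have := e1 x; lia.
rewrite size_filter -sum1_count natr_sum big_map -[iota _ _]/(index_iota 0 N.*2.+1).
rewrite big_mkord big_mkcond; apply: eq_bigr => j _ /=.
rewrite coefs_qn; have := e0 (j%:Z - N%:Z)%R; set z := e _ => z0.
by case: eqP => h; case: eqP => //; lia.
Qed.

(** The triple product modulo q^K, from [finite_jacobi] with x = q^c, y = q^d and N factors of each
    kind. After multiplication by [poch], the Gaussian binomials that matter become 1 modulo q^K. *)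
Lemma jacobi (c d K N : nat) (p : series int) : (0 < c)%N -> (0 < d)%N ->
  (K.*2 < N)%N -> gens (fun n : int => c%:Z * tri n + d%:Z * tri (n - 1)) p ->
  eqs K p (poch (q ^+ (c + d)) N * (\prod_(i < N) (1
    + (q ^+ c) ^+ i.+1 * (q ^+ d) ^+ i) *
     \prod_(i < N) (1 + (q ^+ c) ^+ i * (q ^+ d) ^+ i.+1))).
Proof.
move=> c0 d0 KN hp k kK.
pose e n : int := c%:Z * tri n + d%:Z * tri (n - 1).
have e1 (n : int) : `|n| <= e n + 1.
  have t1 := triE n; have t2 := triE (n - 1).
  have : tri n <= c%:Z * tri n by rewrite ler_peMl ?tri_ge0.
  have : tri (n - 1) <= d%:Z * tri (n - 1) by rewrite ler_peMl ?tri_ge0.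
  have : `|n| <= n * n by clear; nia.
  by rewrite /e; lia.
rewrite (@gens_box e _ N) //; last lia.
rewrite finite_jacobi -exprD addnn mulr_sumr !coefs_sum; apply: eq_bigr => i _.
have hj := ltn_ord i; move: (nat_of_ord i) hj => {i} j hj.
have -> : jmon (q ^+ c) (q ^+ d) (j%:Z - N%:Z)%R = q ^+ `|e (j%:Z
  - N%:Z)%R|%N :> series int.
  rewrite /jmon /e -!exprM -exprD; congr (_ ^+ _).
  by have := tri_ge0 (j%:Z - N%:Z)%R; have := tri_ge0 (j%:Z - N%:Z - 1)%R; nia.
rewrite mulrA [_ * q ^+ _]mulrC.
(* Terms of exponent above [k] vanish on both sides. For the others |j - N| <= K, so j and 2 N - j
   are at least K because N > 2 K, and all the [poch] involved agree modulo q^K. *)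
case: (ltnP k `|e (j%:Z - N%:Z)%R|%N) => h; first by rewrite coefs_qnM h coefs_qn;
  case: eqP => //; lia.
have := e1 (j%:Z - N%:Z)%R => hj1.
have hb : eqs K (poch (q ^+ (c + d)) N * gbinom (q ^+ (c + d)) N.*2 j) 1.
  have cd : (0 < c + d)%N by lia.
  apply: (@eqs_cancel _ _ _ (poch (q ^+ (c + d)) K)); first exact: poch_coef0.
  have g := @gbinom_poch _ (q ^+ (c + d) : series int) N.*2 j.
  rewrite mul1r; apply: eqs_trans (poch_eqs cd (_ : K <= N.*2)%N); last lia.
  rewrite -g; last lia.
  rewrite [poch _ N * _]mulrC; apply: eqs_mul; [apply: eqs_mul => //|].
    by apply: eqs_trans (poch_eqs cd _) (eqs_sym (poch_eqs cd _)); lia.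
  by apply: eqs_sym; apply: poch_eqs => //; lia.
rewrite -[q ^+ _ in LHS]mulr1.
exact: (eqs_mul (fun _ _ => erefl) (eqs_sym hb)).
Qed.

(** The product of 1 - (-q)^m over the m < 4 N not divisible by 4. It approximates phi / psi, and it
    is also the denominator of the generating function at -q. *)
Definition ratio (N : nat) : series int :=
  \prod_(i < N) ((1 + q ^+ (4 * i + 1)) * (1 - q ^+ (4 * i + 2)) * (1
    + q ^+ (4 * i + 3))).

(** Puts n^2 in the shape that [jacobi] expects. *)
Lemma gens_phi_tri : gens (fun n : int => 1%N%:Z * tri n + 1%N%:Z * tri (n - 1)) phi.
Proof.
apply: gens_ext gens_phi (_ : forall n : int, _ = _) => n; rewrite !mul1r.
by have := triE n; have := triE (n - 1); lia.
Qed.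

Lemma gens_psi_tri : gens (fun n : int => 3%N%:Z * tri n + 1%N%:Z * tri (n - 1)) psi.
Proof.
apply: gens_ext gens_psi (_ : forall n : int, _ = _) => n; rewrite mul1r.
by have := triE n; have := triE (n - 1); lia.
Qed.

Lemma prod_double (R : comNzRingType) (F : nat -> R) N :
  \prod_(i < N.*2) F i = \prod_(i < N) (F i.*2 * F i.*2.+1).
Proof.
elim: N => [|N IH]; first by rewrite !big_ord0.
by rewrite doubleS !big_ord_recr /= IH mulrA.
Qed.

(** Two triple products are compared factor by factor. The one for phi advances by q^2 and the one
    for psi by q^4, hence [N.*2] factors against [N]. *)
Lemma phi_psi_ratio K N : (K.*2 < N)%N -> eqs K phi (psi * ratio N).
Proof.
move=> KN.
have h1 := @jacobi 1 1 K N.*2 phi isT isT.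
have h2 := @jacobi 3 1 K N psi isT isT KN.
apply: eqs_trans (h1 _ gens_phi_tri) _; first lia.
apply: eqs_trans (eqs_mul (eqs_sym (h2 gens_psi_tri)) (fun _ _ => erefl)).
move=> k _; congr (coefs _ k).
have -> : poch (q ^+ (1 + 1)) N.*2 = poch (q ^+ (3
  + 1)) N * \prod_(i < N) (1 - q ^+ (4 * i + 2)) :> series int.
  rewrite /poch (prod_double (fun i => 1 - (q ^+ (1 + 1)) ^+ i.+1)) -big_split /=.
  apply: eq_bigr => i _; rewrite -!exprM mulrC.
  by congr ((1 - q ^+ _) * (1 - q ^+ _)); lia.
have o1 : \prod_(i < N.*2) (1 + (q ^+ 1) ^+ i.+1 * (q ^+ 1) ^+ i) =
    \prod_(i < N) (1 + q ^+ (4 * i + 1)) * \prod_(i < N) (1 + q ^+ (4 * i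
      + 3)) :> series int.
  rewrite (prod_double (fun i => 1 + (q ^+ 1) ^+ i.+1 * (q ^+ 1) ^+ i)) -big_split /=.
  apply: eq_bigr => i _; rewrite -!exprM -!exprD.
  by congr ((1 + q ^+ _) * (1 + q ^+ _)); lia.
have -> : \prod_(i < N.*2) (1 + (q ^+ 1) ^+ i * (q ^+ 1) ^+ i.+1) =
    \prod_(i < N.*2) (1 + (q ^+ 1) ^+ i.+1 * (q ^+ 1) ^+ i) :> series int.
  by apply: eq_bigr => i _; rewrite mulrC.
have -> : \prod_(i < N) (1 + (q ^+ 3) ^+ i.+1 * (q ^+ 1) ^+ i) =
    \prod_(i < N) (1 + q ^+ (4 * i + 3)) :> series int.
  by apply: eq_bigr => i _; rewrite -!exprM -!exprD; congr (1 + q ^+ _); lia.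
have -> : \prod_(i < N) (1 + (q ^+ 3) ^+ i * (q ^+ 1) ^+ i.+1) =
    \prod_(i < N) (1 + q ^+ (4 * i + 1)) :> series int.
  by apply: eq_bigr => i _; rewrite -!exprM -!exprD; congr (1 + q ^+ _); lia.
rewrite o1 /ratio !big_split /=; ring.
Qed.

(** * The generating function *)

(** The generating function at -q. *)
Definition RDs : series int := Series (fun k => (-1) ^+ k * (RD 4 9 k)%:R).

Lemma coefs_Nqn m k : ((- q) ^+ m : series int) k = (-1) ^+ m * (k == m)%:R.
Proof.
have e : (- q) ^+ m = (-1) ^+ m * q ^+ m :> series int := exprNn q m.
rewrite e -signr_odd -[in RHS]signr_odd; case: (odd m).
  by rewrite !expr1 !mulN1r coefs_opp coefs_qn.
by rewrite !expr0 !mul1r coefs_qn.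
Qed.

Definition factor (i : nat) : series int :=
  \sum_(j < 9 | (4 %| i)%N ==> (j == ord0)) (- q) ^+ (i * j).

(** Expanding the product by distributivity yields a sum over the multiplicity functions of
    [card_RD]. *)
Lemma RDs_prod M : eqs M RDs (\prod_(i < M) factor i).
Proof.
move=> n nM; rewrite bigA_distr_big_dep /= coefs_sum (card_RD _ _ nM).
rewrite -sum1_card natr_sum big_distrr /= big_mkcond [RHS]big_mkcond.
apply: eq_bigr => f _; rewrite inE prodrXr coefs_Nqn.
rewrite (_ : (f \in _) = [forall i : 'I_M, (4 %| i)%N ==> (f i == ord0)]); last first.
  by [].
case: ifP => [/andP[-> /eqP ->]|]; first by rewrite eqxx.
by case: ifP => //= _ /negbT; rewrite eq_sym => /negPf ->; rewrite mulr0.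
Qed.

Lemma factor4 i : (4 %| i)%N -> factor i = 1.
Proof.
move=> h; rewrite /factor (eq_bigl (pred1 ord0)) => [|j]; last by rewrite h.
by rewrite big_pred1_eq muln0 expr0.
Qed.

Lemma factor_mul i : ~~ (4 %| i)%N ->
  factor i * (1 - (- q) ^+ i) = 1 - (- q) ^+ (9 * i).
Proof.
move=> h; rewrite /factor (eq_bigl xpredT) => [|j]; last by rewrite (negPf h).
have e := subrXX 1 ((- q) ^+ i : series int) 9; rewrite expr1n in e.
rewrite mulnC exprM e mulrC; congr (_ * _).
by apply: eq_bigr => j _; rewrite expr1n mul1r exprM.
Qed.

Lemma prod_quadruple (R : comNzRingType) (F : nat -> R) N :
  \prod_(i < 4 * N) F i =
  \prod_(i < N) (F (4 * i)%N * F (4 * i + 1)%N * F (4 * i + 2)%N * F (4 * i + 3)%N).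
Proof.
elim: N => [|N IH]; first by rewrite muln0 !big_ord0.
have -> : (4 * N.+1 = (4 * N).+4)%N by lia.
by rewrite !big_ord_recr /= IH !mulrA addn1 addn2 addn3.
Qed.

Lemma subs_prod (I : finType) (F : I -> series int) d : (0 < d)%N ->
  subs d (\prod_i F i) = \prod_i subs d (F i).
Proof.
by move=> d0; apply: (big_morph (subs d)) => [p r|]; rewrite ?subsM ?subs1.
Qed.

Lemma Nq_odd k : odd k -> 1 - (- q) ^+ k = 1 + q ^+ k :> series int.
Proof. by move=> ok; rewrite exprNn -signr_odd ok expr1 mulN1r opprK. Qed.

Lemma Nq_even k : ~~ odd k -> 1 - (- q) ^+ k = 1 - q ^+ k :> series int.
Proof. by move=> ok; rewrite exprNn -signr_odd (negPf ok) expr0 mul1r. Qed.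

(** Each [factor] is a geometric sum, so times 1 - (-q)^m it gives 1 - (-q)^(9 m). As 9 m has the
    parity of m, this is the factor of [ratio] with q^9 for q. *)
Lemma RDs_ratio K N : (K <= 4 * N)%N -> eqs K (RDs * ratio N) (subs 3 (subs 3
  (ratio N))).
Proof.
move=> KN.
have hH : eqs K RDs (\prod_(i < 4 * N) factor i) by move=> k kK; apply: RDs_prod; lia.
apply: eqs_trans (eqs_mul hH (fun _ _ => erefl)) _ => k _; congr (coefs _ k).
rewrite prod_quadruple -big_split /= !subs_prod //; apply: eq_bigr => i _.
rewrite factor4 ?dvdn_mulr // mul1r.
have h1 := @factor_mul (4 * i + 1); rewrite !Nq_odd in h1; try lia.
have h2 := @factor_mul (4 * i + 2); rewrite !Nq_even in h2; try lia.
have h3 := @factor_mul (4 * i + 3); rewrite !Nq_odd in h3; try lia.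
rewrite !(subsM, subsD, subsN, subs_q, subs1) //.
have e9 x : (3 * (3 * x) = 9 * x)%N by lia.
rewrite !e9 -h1; last lia.
rewrite -h2; last lia.
rewrite -h3; last lia. ring.
Qed.

Lemma RDs_quotient : RDs * phi * subs 3 (subs 3 psi) = psi * subs 3 (subs 3 phi).
Proof.
apply: seriesP => k; pose K := k.+1; pose N := K.*2.+1.
suff h : eqs K (RDs * phi * subs 3 (subs 3 psi)) (psi * subs 3 (subs 3 phi)).
  by apply: h.
have KN : (K.*2 < N)%N by [].
have hp := phi_psi_ratio KN.
have hp9 := eqs_subs (isT : 0 < 3)%N (eqs_subs (isT : 0 < 3)%N hp).
have hH : eqs K (RDs * ratio N) (subs 3 (subs 3 (ratio N))) by apply: RDs_ratio; lia.
apply: eqs_trans (eqs_mul (eqs_mul (fun _ _ => erefl) hp) (fun _ _ => erefl)) _.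
apply: eqs_trans (eqs_mul (fun _ _ => erefl) (eqs_sym hp9)).
rewrite !subsM // (_ : RDs * (psi * ratio N) * subs 3 (subs 3 psi) =
  psi * (subs 3 (subs 3 psi) * (RDs * ratio N))); last by ring.
by apply: eqs_mul => //; apply: eqs_mul.
Qed.

(** * Sums of two squares, and the conclusion *)

Lemma sqr_mod4 (a : int) : exists m, a ^+ 2 = 4 * m \/ a ^+ 2 = 8 * m + 1.
Proof.
have [m [->|->]] := int_mod2 a; first by exists (m ^+ 2); left; ring.
by exists (tri m); right; have := triE m; lia.
Qed.

Lemma sum_sqr_mod4 (a b t : int) : a ^+ 2 + b ^+ 2 <> 4 * t + 3.
Proof.
by have [m [->|->]] := sqr_mod4 a; have [n [->|->]] := sqr_mod4 b; lia.
Qed.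

(** Division of a + b i by 1 + i in the Gaussian integers, up to signs and order. *)
Lemma sum_sqr_half (a b t : int) : a ^+ 2 + b ^+ 2 = 2 * t ->
  exists c d : int, c ^+ 2 + d ^+ 2 = t.
Proof.
have [m [->|->]] := int_mod2 a; have [n [->|->]] := int_mod2 b => h.
- by exists (m + n), (m - n); lia.
- by lia.
- by lia.
- by exists (m + n + 1), (m - n); lia.
Qed.

Lemma sum_sqr_pow2 (e : nat) (a b t : int) : a ^+ 2 + b ^+ 2 <> 2 ^+ e * (4 * t + 3).
Proof.
elim: e a b => [|e IH] a b; first by rewrite expr0 mul1r; apply: sum_sqr_mod4.
by rewrite (exprS 2) -mulrA => /sum_sqr_half[c [d]]; apply: IH.
Qed.

Lemma RD_dvd24 (k e t : nat) : odd k -> (3 * k + 1 = 2 ^ e * (4 * t + 3))%N ->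
  RD 4 9 (3 * k + 2) = 0 %[mod 24].
Proof.
move=> ok hk.
have h8 := dis_quotient_mod8 RDs_quotient k.
have h3 := dis_quotient_mod3 RDs_quotient k.
have z : (Omega * subs 3 phi) k = 0.
  apply: (gens_coef0 (gens_mul gens_Omega (gens_subs _ gens_phi))) => // -[x y] /= h.
  (* Three times the exponent 3 x^2 + 2 x + 3 y^2, plus 1, is (3 x + 1)^2 + (3 y)^2. *)
  apply: (@sum_sqr_pow2 e (3 * x + 1) (3 * y) t).
  have : (3 * k + 1)%N%:Z = 2 ^+ e * (4 * t%:Z + 3).
    by rewrite hk PoszM PoszD PoszM; congr (_ * _); rewrite -natz natrX.
  by move: h; clear; lia.
have p := phi_Omega_odd ok.
rewrite coefs_add coefs_opp coefs_muln z mul0rn subr0 in h8.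
rewrite coefs_add rpredDr // in h3.
have E : (dis 3 2 RDs) k = (-1) ^+ (3 * k + 2) * (RD 4 9 (3 * k + 2))%:R by [].
(* The sign from q -> -q does not affect divisibility. *)
have ab : `|dis 3 2 RDs k|%N = RD 4 9 (3 * k + 2).
  by rewrite E abszM abszX natz /= exp1n mul1n.
rewrite !dvdzE ab /= in h8 h3.
apply/eqP; rewrite mod0n -/(dvdn 24 _) (@Gauss_dvd 8 3) //.
by rewrite h8 h3.
Qed.

Local Close Scope ring_scope.

Theorem theorem6p1 (n : nat) :
  [/\ RD 4 9 (24 * n + 23) = 0 %[mod 24],
      RD 4 9 (48 * n + 29) = 0 %[mod 24] &
      RD 4 9 (96 * n + 89) = 0 %[mod 24]].
Proof.
split.
- rewrite (_ : 24 * n + 23 = 3 * (8 * n + 7) + 2); last lia.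
  (* Here 3 k + 1 = 24 n + 22 = 2 (12 n + 11). The next two cases have 3 k + 1 = 4 (12 n + 7) and 8
     (12 n + 11). *)
  by apply: (@RD_dvd24 _ 1 (3 * n + 2)); lia.
- rewrite (_ : 48 * n + 29 = 3 * (16 * n + 9) + 2); last lia.
  by apply: (@RD_dvd24 _ 2 (3 * n + 1)); lia.
- rewrite (_ : 96 * n + 89 = 3 * (32 * n + 29) + 2); last lia.
  by apply: (@RD_dvd24 _ 3 (3 * n + 2)); lia.
Qed.
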